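(* Let $f$ be a spectral density on $\Lambda$ and suppose that $f(\lambda)=0$ for almost all $\lambda$ with $e^{i\lambda}\in\Gamma$, where $\Gamma\subset\mathbb T$ is an arc of length $2\delta$ with $0<\delta<\pi$. Then $$\limsup_{n\to\infty}\sqrt[n]{\sigma_n(f)}\le\cos(\delta/2)<1,$$ so in particular $\sigma_n(f)$ decreases to zero exponentially.
   Context: $\Lambda=[-\pi,\pi]$, $\mathbb T$ the unit circle. A spectral density is $f\ge0$, $f\in L^1(\Lambda)$, positive on a set of positive measure. $\sigma_n^2(f)=\min_{c_1,\dots,c_n\in\mathbb C}\int_\Lambda|1-\sum_{k=1}^n c_ke^{-ik\lambda}|^2f(\lambda)\,d\lambda$ and $\sigma_n(f)=\sqrt{\sigma_n^2(f)}$. *)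

(* Defs.v *)
From HB Require Import structures.
From mathcomp Require Import all_boot all_order all_algebra.
From mathcomp Require Import all_classical all_reals all_analysis.
From mathcomp Require Import complex.
Set Implicit Arguments. Unset Strict Implicit. Unset Printing Implicit Defensive.
Import Order.TTheory GRing.Theory Num.Theory ComplexField.
Import numFieldNormedType.Exports.
Local Open Scope classical_set_scope.
Local Open Scope ring_scope.

Definition expi {R : realType} (x : R) : R[i] := (cos x +i* sin x)%C.

Definition Lambda {R : realType} : set R := `[- pi, pi]%classic.

Definition spectral_density {R : realType} (f : R -> R) : Prop :=
  (forall x, Lambda x -> (0 <= f x)%R) /\
  (@lebesgue_measure R).-integrable Lambda (EFin \o f) /\
  (0 < (@lebesgue_measure R) (Lambda `&` [set x | (0 < f x)%R]))%E.

Definition pred_err {R : realType} (n : nat) (c : 'I_n -> R[i]) (x : R) : R[i] :=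
  1 - \sum_(k < n) c k * expi (- ((k.+1)%:R * x)).

Definition sigma2 {R : realType} (f : R -> R) (n : nat) : R :=
  inf [set Rintegral (@lebesgue_measure R) Lambda
         (fun x => Normc.normc (pred_err c x) ^+ 2 * f x) | c in [set: 'I_n -> R[i]]].

Definition sigma {R : realType} (f : R -> R) (n : nat) : R := Num.sqrt (sigma2 f n).

Definition circ_arc {R : realType} (a d : R) : set R[i] :=
  [set z | exists mu : R, a - d <= mu <= a + d /\ z = expi mu].

(* Main.v *)
(** It suffices to exhibit, for [n = 2m], a polynomial of degree [n] in
    [exp (- i x)] with constant term [1] and modulus at most [2 s ^ n],
    [s = cos (d / 2)], on the arc complementary to [Gamma]. As [s] is the
    capacity of that arc, a Chebyshev-type polynomial does it: with
    [u = 2 cos (x - a) + 2 - 2 s^2 = 2 s^2 cos phi] on the complementary arc, take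
    [2 s ^ (2m) cos (m phi)] times a unimodular factor. Hence
    [sigma_n <= 2 s ^ (n - 1) sqrt (\int f)] for all [n >= 2]. *)
Require Import Defs.
From HB Require Import structures.
From mathcomp Require Import all_boot all_order all_algebra.
From mathcomp Require Import all_classical all_reals all_analysis.
From mathcomp Require Import complex measurable_realfun ring lra zify.
Import Order.TTheory GRing.Theory Num.Theory ComplexField.
Import numFieldNormedType.Exports.
Local Open Scope classical_set_scope.
Local Open Scope ring_scope.

(** * Lucas sequences: trigonometric form, bounds, degrees *)

Lemma nat_ind2 (P : nat -> Prop) :
  P 0%N -> P 1%N -> (forall m, P m -> P m.+1 -> P m.+2) -> forall m, P m.
Proof.
move=> P0 P1 IH m; suff [] : P m /\ P m.+1 by [].
by elim: m => [|m [Pm PSm]]; split=> //; exact: IH.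
Qed.

(* Lucas sequence [V_m(u, t)]: a homogenized Chebyshev polynomial, see [lucasV_cos]. *)
Fixpoint lucasV {K : comNzRingType} (u t : K) (m : nat) : K :=
  if m is m'.+1 then
    if m' is m''.+1 then u * lucasV u t m' - t * lucasV u t m'' else u
  else 2.

Lemma lucasVSS (K : comNzRingType) (u t : K) m :
  lucasV u t m.+2 = u * lucasV u t m.+1 - t * lucasV u t m.
Proof. by []. Qed.

Lemma rmorph_lucasV (K L : comNzRingType) (g : {rmorphism K -> L}) u t m :
  g (lucasV u t m) = lucasV (g u) (g t) m.
Proof.
elim/nat_ind2: m => [||m IH0 IH1]; rewrite ?lucasVSS ?rmorphB ?rmorphM ?IH0 ?IH1 //.
by rewrite /= rmorphMn rmorph1.
Qed.

(** [lucasV] is isobaric of weight [m] when [u] has weight 1 and [t] weight 2. This later splits off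
    a unimodular factor [v ^ m]. *)
Lemma lucasV_scale (K : comNzRingType) (v u t : K) m :
  lucasV (v * u) (v ^+ 2 * t) m = v ^+ m * lucasV u t m.
Proof.
elim/nat_ind2: m => [||m IH0 IH1]; rewrite ?lucasVSS ?IH0 ?IH1 /= ?mul1r ?expr1 //.
by rewrite !exprS; ring.
Qed.

(** [lucasV u t m] is the sum of the [m]-th powers of the roots of X^2 - u X + t; here the roots are
    r exp(i x) and r exp(- i x). *)
Lemma lucasV_cos (R : realType) (r x : R) m :
  lucasV (2 * r * cos x) (r ^+ 2) m = 2 * r ^+ m * cos (m%:R * x).
Proof.
elim/nat_ind2: m => [||m IH0 IH1]; rewrite ?lucasVSS ?IH0 ?IH1 /=.
- by rewrite mul0r cos0; ring.
- by rewrite mul1r expr1.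
have -> : m.+2%:R * x = m.+1%:R * x + x by rewrite -(natr1 m.+1); ring.
have -> : m%:R * x = m.+1%:R * x - x by rewrite -(natr1 m); ring.
by rewrite !cosD cosN sinN !exprS; ring.
Qed.

Lemma lucasV_le (R : realType) (r u : R) m :
  0 < r -> - (2 * r) <= u <= 2 * r -> `|lucasV u (r ^+ 2) m| <= 2 * r ^+ m.
Proof.
move=> r0 ur; have r20 : 0 < 2 * r by lra.
have -> : u = 2 * r * cos (acos (u / (2 * r))).
  rewrite acosK; first by field; rewrite gt_eqF.
  by rewrite in_itv /= ler_pdivlMr // ler_pdivrMr // mulN1r mul1r.
rewrite lucasV_cos normrM ger0_norm; last by rewrite mulr_ge0 // exprn_ge0 // ltW.
rewrite ler_piMr //; first by rewrite mulr_ge0 // exprn_ge0 // ltW.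
by rewrite ler_norml cos_geN1 cos_le1.
Qed.

(** The same weights bound the degree: each unit of weight costs degree at most [k]. *)
Lemma size_lucasV (K : comNzRingType) (P Q : {poly K}) k m :
  (size P <= k.+1)%N -> (size Q <= k.*2.+1)%N ->
  (size (lucasV P Q m) <= (k * m).+1)%N.
Proof.
move=> sP sQ; elim/nat_ind2: m => [||m IH0 IH1].
- by rewrite /= -polyC_natr (leq_trans (size_polyC_leq1 _)).
- by rewrite /= muln1.
rewrite lucasVSS (leq_trans (size_polyD _ _)) // size_polyN geq_max.
apply/andP; split; apply: leq_trans (size_polyMleq _ _) _; rewrite -subn1 leq_subLR add1n.
  by have := leq_add sP IH1; rewrite !mulnS !addSn !addnS.
by have := leq_add sQ IH0; rewrite !mulnS !addSn !addnS -addnn -addnA.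
Qed.

(** At X = 0 the recurrence reads V_(m+2) = V_(m+1), with V_1 = 1. The index starts at 1 because V_0
    = 2. *)
Lemma lucasV_coef0 (K : comNzRingType) (P Q : {poly K}) m :
  P`_0 = 1 -> Q`_0 = 0 -> (lucasV P Q m.+1)`_0 = 1.
Proof.
move=> P0 Q0; elim: m => [//|m IH].
by rewrite lucasVSS coefB !coefM !big_ord1 /= IH P0 Q0; ring.
Qed.

(** * Unimodular numbers, the arc, and prediction errors as polynomials *)

Section Expi.
Variable R : realType.
Implicit Types x y : R.

Lemma expi0 : expi (0 : R) = 1.
Proof. by rewrite /expi cos0 sin0. Qed.

Lemma expiD x y : expi (x + y) = expi x * expi y.
Proof.
rewrite /expi cosD sinD; apply/eqP; rewrite eq_complex /=.
by apply/andP; split; apply/eqP; ring.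
Qed.

Lemma expiXn x n : expi x ^+ n = expi (n%:R * x).
Proof.
elim: n => [|n IH]; first by rewrite mul0r expi0.
by rewrite exprS IH -expiD -natr1; congr expi; ring.
Qed.

Lemma normc_expi x : Normc.normc (expi x) = 1.
Proof. by rewrite /= cos2Dsin2 sqrtr1. Qed.

Lemma normc_real x : Normc.normc x%:C%C = `|x|.
Proof. by rewrite /= expr0n addr0 sqrtr_sqr. Qed.

Lemma expiDN x : expi x + expi (- x) = (2 * cos x)%:C%C.
Proof.
rewrite /expi cosN sinN; apply/eqP; rewrite eq_complex /=.
by apply/andP; split; apply/eqP; ring.
Qed.

(** Taking [acos (cos y)] folds [y = x - a] into [0, pi]; as cos decreases there, the result [b] is
    at most [d]. The sign of [sin y] decides between the witnesses [a + b] and [a - b]. *)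
Lemma circ_arc_expi (a d x : R) :
  0 <= d <= pi -> cos d <= cos (x - a) -> circ_arc a d (expi x).
Proof.
move=> d0pi cdx; set y := x - a; set b := acos (cos y).
have cy : -1 <= cos y <= 1 by rewrite cos_geN1 cos_le1.
have b0pi : 0 <= b <= pi by rewrite acos_ge0 // acos_lepi.
have cb : cos b = cos y by rewrite acosK.
have bd : b <= d.
  rewrite leNgt; apply/negP => db; move: cdx; rewrite leNgt -/y -cb.
  by rewrite ltr_cos ?in_itv //= db.
have [sb|sb] : sin b = sin y \/ sin (- b) = sin y.
  rewrite sinN sin_acos // cos2sin2 opprB addrC subrK sqrtr_sqr.
  by have [h|h] := ger0P (sin y); [left | right; rewrite opprK].
- exists (a + b); split; first by lra.
  have -> : x = a + y by rewrite /y; ring.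
  by rewrite (expiD a y) (expiD a b) [expi y]/expi -cb -sb.
- exists (a - b); split; first by lra.
  have -> : x = a + y by rewrite /y; ring.
  by rewrite (expiD a y) (expiD a (- b)) [expi y]/expi -cb -sb -cosN.
Qed.

Lemma pred_err_horner n (p : {poly R[i]}) : p`_0 = 1 -> (size p <= n.+1)%N ->
  exists c : 'I_n -> R[i], forall x, pred_err c x = p.[expi (- x)].
Proof.
move=> p0 sp; exists (fun k => - p`_k.+1) => x.
rewrite (horner_coef_wide _ sp) big_ord_recl /= p0 expr0 mulr1 /pred_err -sumrN.
congr (_ + _); apply: eq_bigr => k _.
by rewrite mulNr opprK expiXn mulrN.
Qed.

(* With [v = exp (i (a - x))] the error is [v ^ m.+1 * lucasV u (s^4) m.+1], a
   polynomial in [exp (- i x)] because [v * u = 1 + (2 - 2 s^2) v + v^2]. For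
   [s = cos (d / 2)], [|u| <= 2 s^2] says exactly that [cos (x - a) <= cos d]. *)
Lemma chebyshev_pred_err (a s : R) m n : (m.+1.*2 <= n)%N ->
  exists c : 'I_n -> R[i], forall x, Normc.normc (pred_err c x) =
    `|lucasV (2 * cos (x - a) + 2 - 2 * s ^+ 2) ((s ^+ 2) ^+ 2) m.+1|.
Proof.
move=> mn; set b := expi a.
have [e eE] : exists e : R, e = 2 - 2 * s ^+ 2 by eexists.
pose P : {poly R[i]} := 1 + (b * e%:C%C) *: 'X + (b ^+ 2) *: 'X^2.
pose Q : {poly R[i]} := (b ^+ 2 * ((s ^+ 2) ^+ 2)%:C%C) *: 'X^2.
have sQ : (size Q <= 3)%N by rewrite (leq_trans (size_scale_leq _ _)) // size_polyXn.
have sP : (size P <= 3)%N.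
  rewrite (leq_trans (size_polyD _ _)) // geq_max (leq_trans (size_polyD _ _)) ?geq_max.
    by rewrite (leq_trans (size_scale_leq _ _)) // size_polyXn.
  by rewrite size_poly1 (leq_trans (size_scale_leq _ _)) // size_polyX.
have [||c hc] := @pred_err_horner n (lucasV P Q m.+1).
- apply: lucasV_coef0; rewrite ?coefD !coefE /=; ring.
- by apply: leq_trans (@size_lucasV _ P Q 2 _ sP _) _; [exact: leq_trans sQ _ | lia].
exists c => x; rewrite hc.
pose v := expi (a - x).
have vb : v = b * expi (- x) by rewrite /v expiD.
rewrite (rmorph_lucasV _ _ (horner_eval (expi (- x))) P Q m.+1 : _.[_] = lucasV _.[_] _.[_] _).
have -> : P.[expi (- x)] = v * (2 * cos (x - a) + e)%:C%C.
  (* Since 2 cos (x - a) = 1/v + v, multiplying by [v] clears the negative power. *)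
  have vV : v * expi (x - a) = 1 by rewrite -expiD addrC addrA subrK subrr expi0.
  have -> : (2 * cos (x - a) + e)%:C%C = expi (x - a) + expi (- (x - a)) + e%:C%C.
    by rewrite expiDN -rmorphD.
  rewrite /P -polyC1 !hornerD !hornerZ hornerX hornerXn hornerC mulrDr mulrDr vV opprB -/v vb.
  by ring.
have -> : Q.[expi (- x)] = v ^+ 2 * ((s ^+ 2) ^+ 2)%:C%C.
  by rewrite /Q hornerZ hornerXn vb; ring.
rewrite lucasV_scale -(rmorph_lucasV _ _ (real_complex R)) Normc.normcM.
by rewrite expiXn normc_expi mul1r normc_real eE addrA.
Qed.
End Expi.

(** * Integrating the bound, then taking roots *)

Lemma measurable_lucasV (R : realType) (D : set R) (u : R -> R) (t : R) m :
  measurable_fun D u -> measurable_fun D (fun x => lucasV (u x) t m).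
Proof.
move=> mu; elim/nat_ind2: m => [||m IH0 IH1] //=.
by apply: measurable_funB; apply: measurable_funM.
Qed.

Lemma sigma2_le (R : realType) (f : R -> R) (a d : R) m n :
  spectral_density f -> 0 < d < pi ->
  {ae (@lebesgue_measure R), forall x : R, Lambda x -> circ_arc a d (expi x) -> f x = 0} ->
  (m.+1.*2 <= n)%N ->
  sigma2 f n <=
    (2 * cos (d / 2) ^+ m.+1.*2) ^+ 2 * Rintegral (@lebesgue_measure R) Lambda f.
Proof.
move=> [f0 [fi _]] d0pi fae mn.
set s := cos (d / 2).
have [c hc] := @chebyshev_pred_err R a s m n mn.
have s0 : 0 < s by apply: cos_gt0_pihalf; lra.
have s2 : 2 * s ^+ 2 = 1 + cos d.
  have := cos_mulr2n (d / 2); rewrite -/s (_ : d / 2 *+ 2 = d); last by field.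
  by move->; ring.
pose K := (2 * s ^+ m.+1.*2) ^+ 2.
have mL : measurable (@Lambda R) by exact: measurable_itv.
have mf : measurable_fun (@Lambda R) f.
  by apply/measurable_EFinP; exact: measurable_int fi.
pose g x := Normc.normc (pred_err c x) ^+ 2 * f x.
have g0 x : Lambda x -> 0 <= g x by move=> Lx; rewrite mulr_ge0 ?sqr_ge0 ?f0.
have mg : measurable_fun (@Lambda R) g.
  (* The real closed form of the modulus reduces measurability to real functions. *)
  have -> : g = (fun x => `|lucasV (2 * cos (x - a) + 2 - 2 * s ^+ 2)
                             ((s ^+ 2) ^+ 2) m.+1| ^+ 2 * f x).
    by apply/funext => x; rewrite /g hc.
  apply: measurable_funM => //; apply: measurable_funX.
  apply: measurableT_comp => //; apply: measurable_lucasV.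
  do 2 apply: measurable_funD => //.
  apply: measurable_funM => //; apply: measurableT_comp; last exact: measurable_funB.
  by apply: continuous_measurable_fun; exact: continuous_cos.
have K0 : 0 <= K by exact: sqr_ge0.
have gK : {ae (@lebesgue_measure R),
    forall x, Lambda x -> ((g x)%:E <= (K * f x)%:E)%E}.
  move: fae; apply: filterS; first exact: (ae_filter_ringOfSetsType (@lebesgue_measure R)).
  move=> x fx Lx; rewrite lee_fin /g hc.
  (* On the arc the density vanishes; off it the Chebyshev bound applies. *)
  have [cle|clt] := leP (cos d) (cos (x - a)).
    by rewrite fx ?mulr0 //; apply: circ_arc_expi => //; lra.
  apply: ler_wpM2r; first exact: f0.
  apply: lerXn2r; rewrite ?nnegrE //; first by rewrite mulr_ge0 // exprn_ge0 // ltW.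
  rewrite -mul2n exprM; apply: lucasV_le; first exact: exprn_gt0.
  (* With 2 s^2 = 1 + cos d, the upper bound on [u] is cos (x - a) <= cos d and the lower one is cos
     (x - a) >= -1. *)
  by rewrite s2; have := cos_geN1 (x - a); lra.
have KfE : (@lebesgue_measure R).-integrable Lambda (EFin \o (fun x => K * f x)).
  by rewrite (_ : _ \o _ = (fun x => K%:E * (EFin \o f) x)%E) //; exact: integrableZl.
have Kf0 x : Lambda x -> 0 <= K * f x by move=> Lx; rewrite mulr_ge0 ?f0.
apply: (@le_trans _ _ (Rintegral (@lebesgue_measure R) Lambda g)).
  apply: ge_inf; last by exists c.
  (* An infimum lies below its members only for a set bounded below; 0 serves. *)
  exists 0 => _ [c' _ <-]; apply: Rintegral_ge0 => x Lx.
  by rewrite mulr_ge0 ?sqr_ge0 ?f0.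
rewrite -RintegralZl // /Rintegral.
have le : (\int[@lebesgue_measure R]_(x in Lambda) (g x)%:E <=
           \int[@lebesgue_measure R]_(x in Lambda) (K * f x)%:E)%E.
  apply: ae_ge0_le_integral => //.
  - exact/measurable_EFinP.
  - exact: measurable_int KfE.
(* Finiteness matters because [fine] sends infinite values to 0. *)
have fin : (\int[@lebesgue_measure R]_(x in Lambda) (K * f x)%:E)%E \is a fin_num.
  exact: integrable_fin_num.
apply: fine_le => //.
rewrite ge0_fin_numE; first by apply: le_lt_trans le _; rewrite -ge0_fin_numE // integral_ge0.
by apply: integral_ge0 => x Lx; rewrite lee_fin g0.
Qed.

(** The slack [e] absorbs the constant: C (s / (s + e))^n tends to 0, so C s^n <= (s + e)^n
    eventually, and the root is taken only afterwards. *)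
Lemma near_root_le (R : realType) (u : nat -> R) (s C : R) :
  0 < s -> (forall n, 0 <= u n) ->
  (\forall n \near \oo, u n <= C * s ^+ n) ->
  forall e, 0 < e -> \forall n \near \oo, u n `^ (n%:R^-1) <= s + e.
Proof.
move=> s0 u0 uC e e0.
have q1 : `|s / (s + e)| < 1.
  by rewrite ger0_norm ?divr_ge0 ?ltr_pdivrMr ?mul1r //; lra.
have /cvgr_lt : (fun n => C * (s / (s + e)) ^+ n) @ \oo --> C * 0.
  by apply: cvgM; [exact: cvg_cst | exact: cvg_expr].
rewrite mulr0 => /(_ 1 ltr01) hq.
near=> n.
have n0 : (0 < n)%N by near: n; exists 1%N.
have se0 : 0 <= s + e by lra.
have le : u n <= (s + e) ^+ n.
  apply: (@le_trans _ _ (C * s ^+ n)); first by near: n.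
  have : C * (s / (s + e)) ^+ n < 1 by near: n.
  rewrite expr_div_n mulrA ltr_pdivrMr ?mul1r; first exact: ltW.
  by rewrite exprn_gt0 //; lra.
have /(ge0_ler_powR (r := n%:R^-1)) : u n \is Num.nneg by rewrite nnegrE.
move=> /(_ _ ((s + e) ^+ n)); rewrite invr_ge0 ler0n => /(_ isT).
rewrite nnegrE exprn_ge0 // => /(_ isT le).
by rewrite -powR_mulrn // -powRrM mulfV ?powRr1 // pnatr_eq0 -lt0n.
Unshelve. all: by end_near.
Qed.

Theorem mainTheorem2 (R : realType) (f : R -> R) (a d : R) :
  spectral_density f ->
  0 < d < pi ->
  {ae (@lebesgue_measure R), forall x : R, Lambda x -> circ_arc a d (expi x) -> f x = 0} ->
  (forall e : R, 0 < e ->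
     \forall n \near \oo, sigma f n `^ (n%:R^-1) <= cos (d / 2) + e)
  /\ cos (d / 2) < 1.
Proof.
move=> fd d0pi fae; have pi0 := pi_gt0 R.
have s0 : 0 < cos (d / 2) by apply: cos_gt0_pihalf; lra.
have s1 : cos (d / 2) < 1 by rewrite -[ltRHS]cos0 ltr_cos ?in_itv /=; lra.
split=> //; set s := cos (d / 2) in s0 s1 *.
set I := Rintegral (@lebesgue_measure R) Lambda f.
(* The division by [s] pays for odd [n], where only the exponent [n - 1] is available. *)
apply: (@near_root_le _ _ _ (2 * Num.sqrt I / s)) => //.
  by move=> n; exact: sqrtr_ge0.
exists 2%N => // n /= n2.
(* [m.+1.*2] is the largest even number up to [n]; it is positive since [n >= 2]. *)
have [m nE] : exists m, n = (odd n + m.+1.*2)%N.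
  by exists n./2.-1; rewrite -{1}[n]odd_double_half; lia.
have mn : (m.+1.*2 <= n)%N by lia.
have sp (k : nat) : 0 <= s ^+ k by rewrite exprn_ge0 // ltW.
apply: (@le_trans _ _ (2 * s ^+ m.+1.*2 * Num.sqrt I)).
  have -> : 2 * s ^+ m.+1.*2 = Num.sqrt ((2 * s ^+ m.+1.*2) ^+ 2).
    by rewrite sqrtr_sqr ger0_norm // mulr_ge0.
  by rewrite -sqrtrM ?sqr_ge0 // ler_wsqrtr //; exact: sigma2_le fae mn.
rewrite [leRHS](_ : _ = 2 * (s ^+ n / s) * Num.sqrt I); last by field; rewrite gt_eqF.
rewrite ler_wpM2r ?sqrtr_ge0 // ler_wpM2l // ler_pdivlMr // -exprSr.
by rewrite ler_wiXn2l //; [lra | lra | rewrite nE; case: (odd n)].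
Qed.
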